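(* Let $k\in \mathbb{Z}$ and $n,m,d\in\mathbb{Z}^+$ with $n\geq 2$ and $k\not\equiv 0\pmod n$, let $T_{m,d}$ be the rooted complete $m$-ary tree of height $d$, and write $\delta = \lfloor d/2 \rfloor$. If $d$ is even, then $\chi_{(n,k)}(T_{m,d})$ exists if and only if \[ n\mid \left( k \, \frac{m^{\delta +1}+ (-1)^{\delta}}{m+1} \right), \] and in that case $\chi_{(n,k)}(T_{m,d}) \leq d+1$. If $d$ is odd, then $\chi_{(n,k)}(T_{m,d})$ always exists; if $n\mid \left( k \, \frac{m^{\delta +1}+ (-1)^{\delta}}{m+1} \right)$ then $\chi_{(n,k)}(T_{m,d}) \leq d + 1$, and otherwise $\chi_{(n,k)}(T_{m,d}) \leq d+\delta+2$.
   Context: $T_{m,d}$ is the rooted tree in which every vertex at distance less than $d$ from the root has exactly $m$ children and all leaves are at distance $d$ from the root. For a graph $G=(V,E)$, a $\mathbb{Z}$-labeling is a map $\ell:V\to\mathbb{Z}$; its order is the size of its range; it is proper if adjacent vertices get different labels. $N(v)$ is the open neighborhood of $v$. An open coloring with remainder $k \bmod n$ is a labeling with $\sum_{w\in N(v)}\ell(w)\equiv k \pmod n$ for all $v\in V$. If no proper such coloring exists, $\chi_{(n,k)}(G)$ does not exist; otherwise it is the minimum order of a proper open coloring with remainder $k\bmod n$. *)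

(* Defs.v *)
From HB Require Import structures.
From mathcomp Require Import all_boot all_order all_algebra.
From mathcomp Require Import zify ring.
From Stdlib Require Import Classical.

Set Implicit Arguments.
Unset Strict Implicit.
Unset Printing Implicit Defensive.

Import Order.TTheory GRing.Theory Num.Theory.
Local Open Scope ring_scope.

Record sgraph := SGraph {
  vertex :> finType;
  adj : rel vertex;
  adj_sym : symmetric adj;
  adj_irrefl : irreflexive adj
}.

Definition nbhd (G : sgraph) (v : G) : {set G} := [set w | adj v w].

Definition label_order (G : sgraph) (l : G -> int) : nat :=
  size (undup (codom l)).

Definition proper (G : sgraph) (l : G -> int) : Prop :=
  forall u v : G, adj u v -> l u <> l v.

Definition open_coloring (G : sgraph) (n : nat) (k : int) (l : G -> int) : Prop :=
  forall v : G, (\sum_(w in nbhd v) l w = k %[mod n%:Z])%Z.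

Definition chi_exists (G : sgraph) (n : nat) (k : int) : Prop :=
  exists l : G -> int, proper l /\ open_coloring n k l.

(* [is_chi G n k c] reads "chi_(n,k)(G) exists and is equal to c". *)
Definition is_chi (G : sgraph) (n : nat) (k : int) (c : nat) : Prop :=
  (exists l : G -> int,
     [/\ proper l, open_coloring n k l & label_order l = c]) /\
  (forall l : G -> int,
     proper l -> open_coloring n k l -> (c <= label_order l)%N).

Definition chi_le (G : sgraph) (n : nat) (k : int) (b : nat) : Prop :=
  exists c : nat, is_chi G n k c /\ (c <= b)%N.

Lemma chi_existsP (G : sgraph) (n : nat) (k : int) :
  chi_exists G n k <-> exists c : nat, is_chi G n k c.
Proof.
split=> [[l [pl ol]] | [c [[l [pl ol _]] _]]]; last by exists l.
have [b def_b] : exists b, label_order l = b by exists (label_order l).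
elim/ltn_ind: b l pl ol def_b => b IHb l pl ol def_b.
have [[l' [pl' ol' lt_l']] | minb] := classic (exists l' : G -> int,
  [/\ proper l', open_coloring n k l' & (label_order l' < b)%N]).
  exact: (IHb _ lt_l' l').
exists b; split=> [|l' pl' ol']; first by exists l.
by rewrite leqNgt; apply/negP => lt_l'; apply: minb; exists l'.
Qed.

(* A vertex of T_{m,d} is a word of length at most d over 'I_m, the empty word
   being the root; the word lists the child indices met on the way from the
   vertex up to the root, so the children of u are the words i :: u. *)
Definition tree_vertex (m d : nat) : finType := d.-bseq 'I_m.

Definition is_child (m d : nat) (u v : tree_vertex m d) : bool :=
  [exists i : 'I_m, (v : seq 'I_m) == i :: u].

Definition tree_adj (m d : nat) : rel (tree_vertex m d) :=
  fun u v => is_child u v || is_child v u.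

Lemma tree_adj_sym (m d : nat) : symmetric (@tree_adj m d).
Proof. by move=> u v; rewrite /tree_adj orbC. Qed.

Lemma tree_adj_irrefl (m d : nat) : irreflexive (@tree_adj m d).
Proof.
move=> u; rewrite /tree_adj orbb; apply/existsP=> -[i /eqP/(congr1 size)] /=.
by move/eqP; rewrite eqn_leq ltnn andbF.
Qed.

Definition mary_tree (m d : nat) : sgraph :=
  SGraph (@tree_adj_sym m d) (@tree_adj_irrefl m d).

Lemma card_children (m d : nat) (u : tree_vertex m d) :
  #|[set v | is_child u v]| = if (size u < d)%N then m else 0%N.
Proof.
case: ltnP => [ltud | ledu]; last first.
  apply: eq_card0 => v; rewrite inE; apply/existsP => -[i /eqP/(congr1 size)] /=.
  by move=> sz_v; have := size_bseq v; rewrite sz_v ltnNge ledu.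
pose f (i : 'I_m) : tree_vertex m d := Bseq (ltud : (size (i :: u) <= d)%N).
rewrite -[RHS]card_ord -(card_imset predT (f := f)) => [|i j /(congr1 val)[]//].
apply: eq_card => v; rewrite inE; apply/existsP/imsetP => [[i /eqP vE]|[i _ ->]].
  by exists i => //; apply: val_inj.
by exists i.
Qed.

Definition tree_quot (m e : nat) : int :=
  ((m%:Z ^+ e.+1 + (-1) ^+ e) %/ (m%:Z + 1))%Z.

(* The division in [tree_quot] is exact. *)
Lemma tree_quotE (m e : nat) :
  tree_quot m e * (m%:Z + 1) = m%:Z ^+ e.+1 + (-1) ^+ e.
Proof.
rewrite /tree_quot divzK //; elim: e => [|e IHe].
  by rewrite expr1 expr0 dvdzz.
have -> : m%:Z ^+ e.+2 + (-1) ^+ e.+1 =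
    m%:Z ^+ e.+1 * (m%:Z + 1) - (m%:Z ^+ e.+1 + (-1) ^+ e).
  by rewrite (exprS _ e.+1) (exprS (-1)); ring.
by rewrite rpredB ?dvdz_mull.
Qed.

(* Main.v *)
(** Measure the height of a vertex from the leaves.  A leaf forces the label of
    its parent to be [k], and then the condition at a vertex of even height [h]
    forces the labels at height [h + 1]: modulo [n], every vertex of height
    [2j + 1] has label [S_(j+1)], where [S_0 = 0] and [S_(j+1) = k - m S_j].
    When [d] is even the condition at the root then reads [S_(delta+1) = 0],
    and [S_(delta+1)] is the number of the theorem up to sign.  Conversely, if
    [S_(delta+1) = 0], labelling height [h] with [S_(ceil(h/2))] satisfies all
    conditions, and representatives can be chosen distinct on distinct levels.
    When [d] is odd, the even heights are not forced: there each vertex can be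
    labelled [0] or [k] so that the children of a vertex whose parent is
    labelled [k] are all labelled [0], and otherwise exactly one child is
    labelled [k]. *)

Require Import Defs.
From mathcomp Require Import all_boot all_order all_algebra.
From mathcomp Require Import zify ring.

Set Implicit Arguments.
Unset Strict Implicit.
Unset Printing Implicit Defensive.

Import Order.TTheory GRing.Theory Num.Theory.
Local Open Scope ring_scope.

Lemma label_order_le (G : sgraph) (l : G -> int) (s : seq int) :
  (forall v, l v \in s) -> (label_order l <= size s)%N.
Proof.
move=> ls; apply: uniq_leq_size; first exact: undup_uniq.
by move=> x; rewrite mem_undup => /codomP[v ->].
Qed.

Lemma chi_le_witness (G : sgraph) (n : nat) (k : int) (b : nat) (l : G -> int) :
  Defs.proper l -> open_coloring n k l -> (label_order l <= b)%N -> chi_le G n k b.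
Proof.
move=> pl ol lb.
have [c Hc] : exists c, is_chi G n k c by apply/chi_existsP; exists l.
by exists c; split=> //; apply: leq_trans lb; apply: Hc.2.
Qed.

Lemma chi_le_exists (G : sgraph) (n : nat) (k : int) (b : nat) :
  chi_le G n k b -> chi_exists G n k.
Proof. by case=> c [Hc _]; apply/chi_existsP; exists c. Qed.

Section Tree.

Variables m d : nat.
Implicit Types (v w : mary_tree m d) (f : seq 'I_m -> int).

(** [f] takes arbitrary words, so [i :: v] needs no proof of its length bound. *)
Lemma sum_children f v :
  \sum_(w | is_child v w) f w =
  if (size v < d)%N then \sum_(i < m) f (i :: v) else 0.
Proof.
case: ltnP => [ltvd | ledv]; last first.
  apply: big_pred0 => w; apply/existsP => -[i /eqP/(congr1 size)] /= sz_w.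
  by have := size_bseq w; rewrite sz_w ltnNge ledv.
pose c (i : 'I_m) : mary_tree m d := Bseq (ltvd : (size (i :: v) <= d)%N).
have c_inj : injective c by move=> i j /(congr1 val)[].
rewrite -(big_imset (h := c) (A := predT) (fun w : mary_tree m d => f w)) /=; last first.
  by move=> i j _ _; apply: c_inj.
apply: eq_bigl => w; apply/existsP/imsetP => [[i /eqP wE]|[i _ ->]].
  by exists i => //; apply: val_inj.
by exists i.
Qed.

Lemma sum_parent f v :
  \sum_(w | is_child w v) f w = if (0 < size v)%N then f (behead v) else 0.
Proof.
case: v => -[|i u] /= sv.
  by apply: big_pred0 => w; apply/existsP => -[j].
pose p : mary_tree m d := Bseq (ltnW sv).
rewrite (big_pred1 p) // => w /=; apply/existsP/eqP => [[j /= /eqP[_ uE]]|->].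
  by apply: val_inj.
by exists i.
Qed.

Lemma sum_nbhd f v :
  \sum_(w in nbhd v) f w =
  (if (size v < d)%N then \sum_(i < m) f (i :: v) else 0) +
  (if (0 < size v)%N then f (behead v) else 0).
Proof.
rewrite -sum_children -sum_parent (bigID (is_child v)) /=.
congr (_ + _); apply: eq_bigl => w; rewrite inE /= /tree_adj.
  by rewrite andbC; case: (is_child v w).
case: (boolP (is_child v w)) => [/existsP[i /eqP wE]|]; last by rewrite andbT.
rewrite andbF; apply/esym/existsP => -[j /eqP/(congr1 size)].
by rewrite wE /=; lia.
Qed.

Lemma tree_adj_size v w :
  adj v w -> (size v).+1 = size w \/ (size w).+1 = size v.
Proof.
by case/orP => /existsP[i /eqP ->]; [left | right].
Qed.

End Tree.

Fixpoint alt_sum (m : nat) (k : int) (j : nat) : int :=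
  if j is i.+1 then k - m%:Z * alt_sum m k i else 0.

(** The recurrence solves to [S_j (m + 1) = k (1 - (-m)^j)]; cancel [m + 1] at [j = e + 1]. *)
Lemma alt_sum_quot m k e :
  alt_sum m k e.+1 = (-1) ^+ e * (k * tree_quot m e).
Proof.
have E j : alt_sum m k j * (m%:Z + 1) = k * (1 - (- m%:Z) ^+ j).
  elim: j => [|j IH]; first by rewrite expr0 subrr mulr0 mul0r.
  rewrite [alt_sum _ _ _]/= mulrBl -mulrA IH exprS; ring.
apply: (@mulIf _ (m%:Z + 1)); first by lia.
have sq : (-1) ^+ e * (-1) ^+ e = 1 :> int by rewrite -expr2 sqrr_sign.
rewrite E -!mulrA tree_quotE (exprNn m%:Z) (exprS (-1)) -[X in X - _]sq; ring.
Qed.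

Lemma dvdz_alt_sum (n m : nat) (k : int) e :
  (n%:Z %| alt_sum m k e.+1)%Z = (n%:Z %| k * tree_quot m e)%Z.
Proof. by rewrite alt_sum_quot !dvdzE abszMsign. Qed.

(* The representative of the class of [x] in the [j]-th block of length [n]. *)
Definition repz (n : nat) (x : int) (j : nat) : int :=
  (x %% n%:Z)%Z + n%:Z * j%:Z.

Lemma repz_mod n x j : (repz n x j %% n%:Z = x %% n%:Z)%Z.
Proof. by rewrite /repz addrC mulrC modzMDl modz_mod. Qed.

Lemma repz_inj n x y i j : (0 < n)%N -> repz n x i = repz n y j -> i = j.
Proof.
move=> n0 /(congr1 (fun z => (z %/ n%:Z)%Z)).
rewrite /repz !(addrC (_ %% _)%Z) !(mulrC n%:Z) !divzMDl; try lia.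
by rewrite !divz_small ?addr0; [case | rewrite modz_ge0 ?ltz_pmod; lia..].
Qed.

(** Only residues matter, so each label may move to a chosen block; by [repz_inj], different blocks
    give different labels. *)
Lemma open_coloring_repz (G : sgraph) n k (g : G -> int) (j : G -> nat) :
  open_coloring n k g -> open_coloring n k (fun v => repz n (g v) (j v)).
Proof.
move=> gP v; rewrite -(gP v); apply/eqP.
rewrite eqz_mod_dvd -sumrB; apply: rpred_sum => w _.
by rewrite -eqz_mod_dvd repz_mod.
Qed.

(** At a non-root vertex of height [h], with [j = floor(h/2)], children carry [S_j] and the parent
    [S_(j+1)], so the recurrence gives exactly [k]; at a leaf, [S_0 = 0]. Divisibility serves only
    the root. *)
Lemma level_coloring (n m d : nat) (k : int) : (0 < d)%N ->
  (n%:Z %| alt_sum m k d./2.+1)%Z ->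
  open_coloring (G := mary_tree m d) n k
    (fun v => alt_sum m k (uphalf (d - size v))).
Proof.
move=> d0 nS v.
have := sum_nbhd (fun s => alt_sum m k (uphalf (d - size s))) v => /= ->.
have vd : (size v <= d)%N by apply: size_bseq.
rewrite size_behead big_const_ord iter_addr_0 -mulr_natl.
case: (posnP (size v)) => [-> | v0].
  rewrite d0 addr0; apply/eqP; rewrite eq_sym eqz_mod_dvd.
  have -> : uphalf (d - 1) = d./2 by case: (d) d0 => //= e _; rewrite subn1.
  by rewrite natz.
have -> : (d - (size v).-1 = (d - size v).+1)%N.
  by rewrite -subSS prednK // subSn.
case: ltnP => [ltvd | ledv].
  by rewrite -(subnSK ltvd) natz /= addrC subrK.
have /eqP -> : (d - size v == 0)%N by rewrite subn_eq0.
by rewrite /= mulr0 subr0 add0r.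
Qed.

Lemma chi_le_levels (n m d : nat) (k : int) : (0 < n)%N -> (0 < d)%N ->
  (n%:Z %| alt_sum m k d./2.+1)%Z -> chi_le (mary_tree m d) n k (d + 1).
Proof.
move=> n0 d0 nS.
(* Each of the [d + 1] levels gets its own block. *)
have lP := open_coloring_repz (fun v : mary_tree m d => size v) (level_coloring d0 nS).
apply: (chi_le_witness _ lP).
  by move=> u v uv /(repz_inj n0) E; case: (tree_adj_size uv); lia.
pose F i := repz n (alt_sum m k (uphalf (d - i))) i.
rewrite addn1 -(size_iota 0 d.+1) -(size_map F).
apply: label_order_le => v; apply: (map_f F).
by rewrite mem_iota /= ltnS; apply: size_bseq.
Qed.

(* Which vertices of even height get the label [k] rather than [0] when [d] is
   odd; only words of odd length matter. *)
Fixpoint marked (m : nat) (s : seq 'I_m) : bool :=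
  if s is i :: u then
    (val i == 0%N) && (if u is _ :: p then ~~ marked p else true)
  else false.

(** If the parent of [u] is marked, no child is; otherwise exactly child 0 is. At the root, [behead
    [::]] is the unmarked empty word. *)
Lemma sum_marked (m : nat) (k : int) (u : seq 'I_m) : (0 < m)%N ->
  \sum_(i < m) (if marked (i :: u) then k else 0) +
  (if marked (behead u) then k else 0) = k.
Proof.
case: m u => // m u _; rewrite big_ord_recl big1 /= ?addr0 //.
by case: u => [|i p] /=; [rewrite addr0 | case: (marked p); rewrite ?add0r ?addr0].
Qed.

Lemma odd_coloring (n m d : nat) (k : int) : (0 < m)%N -> odd d ->
  open_coloring (G := mary_tree m d) n k
    (fun v => if odd (size v) then if marked v then k else 0
              else alt_sum m k (uphalf (d - size v))).
Proof.
move=> m0 od v; congr (_ %% _)%Z.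
have := sum_nbhd (fun s => if odd (size s) then if marked s then k else 0
  else alt_sum m k (uphalf (d - size s))) v => /= ->.
have vd : (size v <= d)%N by apply: size_bseq.
rewrite size_behead; case: (boolP (odd (size v))) => ov /=; last first.
  (* Since [d] is odd, a vertex of even depth is not a leaf. *)
  have -> : (size v < d)%N.
    by rewrite ltn_neqAle vd andbT; apply: contraNneq ov => ->.
  rewrite -[RHS](sum_marked k v m0); congr (_ + _).
  by case: (bseqval v) ov => //= i u ou; rewrite -(negbK (odd _)) ou.
have v0 : (0 < size v)%N by case: (size v) ov.
have -> : odd (size v).-1 = false by case: (size v) ov => //= ? /negbTE.
rewrite v0 big_const_ord iter_addr_0 -mulr_natl.
have -> : (d - (size v).-1 = (d - size v).+1)%N.
  by rewrite -subSS prednK // subSn.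
case: ltnP => [ltvd | ledv].
  by rewrite -(subnSK ltvd) natz /= addrC subrK.
have /eqP -> : (d - size v == 0)%N by rewrite subn_eq0.
by rewrite /= mulr0 subr0 add0r.
Qed.

Lemma chi_le_odd (n m d : nat) (k : int) : (0 < n)%N -> (0 < m)%N -> odd d ->
  chi_le (mary_tree m d) n k (d./2 + 3).
Proof.
move=> n0 m0 od.
(* Odd depths share block 0 and two labels; each of the [d./2 + 1] even depths has its own nonzero
   block. *)
have lP := open_coloring_repz
  (fun v : mary_tree m d => if odd (size v) then 0%N else (size v).+1)
  (odd_coloring n k m0 od).
apply: (chi_le_witness _ lP).
  move=> u v uv /(repz_inj n0).
  by case: (tree_adj_size uv) => <- /=; case: (odd _).
pose F i := repz n (alt_sum m k (uphalf (d - i.*2))) i.*2.+1.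
pose s := [:: repz n k 0, repz n 0 0 & [seq F i | i <- iota 0 d./2.+1]].
have -> : (d./2 + 3)%N = size s by rewrite /= size_map size_iota addn3.
apply: label_order_le => v; rewrite 2!in_cons.
case: (boolP (odd (size v))) => ov; first by case: (marked v); rewrite eqxx ?orbT.
have vE : size v = (size v)./2.*2 by rewrite even_halfK.
apply/orP; right; apply/orP; right; rewrite vE; apply: (map_f F).
by rewrite mem_iota /= ltnS; apply/half_leq/size_bseq.
Qed.

Section Necessity.

Variables (n m d : nat) (k : int) (l : mary_tree m d -> int).
Hypotheses (m0 : (0 < m)%N) (lP : open_coloring n k l).

Let f (s : seq 'I_m) : int := l (insubd [bseq] s).

Let fE (v : mary_tree m d) : l v = f v.
Proof. by rewrite /f /insubd; case: v => s sd; rewrite insubT. Qed.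

Let nbhd_sum (s : seq 'I_m) : (size s <= d)%N ->
  (n%:Z %| (if (size s < d)%N then \sum_(i < m) f (i :: s) else 0) +
    (if (0 < size s)%N then f (behead s) else 0) - k)%Z.
Proof.
move=> sd; have := lP (Bseq sd : mary_tree m d).
rewrite (eq_bigr (fun w : mary_tree m d => f w)) => [|w _]; last exact: fE.
by rewrite sum_nbhd /= => /eqP; rewrite eqz_mod_dvd.
Qed.

(** Apply the condition at child 0 of [s]: it is a leaf if [j = 0], and otherwise its children fall
    under the induction hypothesis. *)
Lemma odd_height_forced (j : nat) (s : seq 'I_m) :
  (size s + j.*2.+1)%N = d ->
  (n%:Z %| f s - alt_sum m k j.+1)%Z.
Proof.
elim: j s => [|j IH] s sE.
  have sd : (size s).+1 = d by rewrite -sE addn1.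
  have := nbhd_sum (s := Ordinal m0 :: s).
  by rewrite /= mulr0 subr0 sd leqnn ltnn add0r => /(_ isT).
have sd : ((size s).+1 < d)%N by rewrite -sE; lia.
have /= := nbhd_sum (s := Ordinal m0 :: s) (ltnW sd); rewrite sd => H.
have E : (n%:Z %| \sum_(i < m) f [:: i, Ordinal m0 & s] - m%:Z * alt_sum m k j.+1)%Z.
  rewrite -natz mulr_natl -[X in _ *+ X]card_ord -sumr_const -sumrB.
  by apply: rpred_sum => i _; apply: IH; rewrite /=; lia.
have := rpredB H E; congr (_ %| _)%Z.
by rewrite /=; ring.
Qed.

Lemma even_root_dvd : (0 < d)%N -> ~~ odd d -> (n%:Z %| alt_sum m k d./2.+1)%Z.
Proof.
move=> d0 ed; have dE : d = d./2.*2 by rewrite even_halfK.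
have := nbhd_sum (s := [::]) isT; rewrite /= d0 addr0 => H.
(* The root's children have odd height [d - 1], so their labels are forced. *)
have E : (n%:Z %| \sum_(i < m) f [:: i] - m%:Z * alt_sum m k d./2)%Z.
  rewrite -natz mulr_natl -[X in _ *+ X]card_ord -sumr_const -sumrB.
  apply: rpred_sum => i _; have -> : d./2 = d./2.-1.+1 by lia.
  by apply: odd_height_forced; rewrite /=; lia.
have := rpredB E H; congr (_ %| _)%Z; rewrite /=; ring.
Qed.

End Necessity.

Theorem theorem6p12 (k : int) (n m d : nat)
  (hn : (2 <= n)%N) (hm : (0 < m)%N) (hd : (0 < d)%N)
  (hk : ~ (k = 0 %[mod n%:Z])%Z) :
  let delta := (d %/ 2)%N in
  let T := mary_tree m d in
  let cond := (n%:Z %| k * tree_quot m delta)%Z in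
  (~~ odd d ->
     (chi_exists T n k <-> cond) /\
     (cond -> chi_le T n k (d + 1)%N)) /\
  (odd d ->
     [/\ chi_exists T n k,
         cond -> chi_le T n k (d + 1)%N
       & ~~ cond -> chi_le T n k (d + delta + 2)%N]).
Proof.
move=> delta T cond; have n0 : (0 < n)%N by apply: ltnW.
have condE : cond = (n%:Z %| alt_sum m k d./2.+1)%Z.
  by rewrite dvdz_alt_sum /cond /delta divn2.
have le_lev : cond -> chi_le T n k (d + 1).
  by rewrite condE; apply: chi_le_levels.
split=> [ed | od].
  split=> //; split=> [[l [_ lP]] | /le_lev/chi_le_exists//].
  by rewrite condE; apply: even_root_dvd lP hd ed.
have le_odd := chi_le_odd k n0 hm od.
split=> // [|_]; first exact: chi_le_exists le_odd.
case: le_odd => c [cP le_c]; exists c; split=> //.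
(* [delta + 3 <= d + delta + 2] because [d >= 1]. *)
by apply: leq_trans le_c _; rewrite /delta divn2; lia.
Qed.
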